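(* Let $\mathcal{H}$ be the $\mathbb{Z}^2$ hard square shift, $h = h^{top}(\mathcal{H})$, and for $n\ge 1$ let $h_n = h^{top}(H_n(\mathcal{H}))$ be the topological entropy of the associated horizontal strip shift of height $n$. Then $\lim_{n\to\infty} (h_{n+1}-h_n) = h$, and the rate of this convergence is at least exponential; that is, there exist constants $A,B>0$ such that $|h_{n+1}-h_n-h|\le A e^{-Bn}$ for all $n\geq 1$.
   Context: Sites $u,v\in\mathbb{Z}^d$ are adjacent if $\sum_i|u_i-v_i|=1$. The $\mathbb{Z}^2$ hard square shift $\mathcal{H}$ is the set of $x\in\{0,1\}^{\mathbb{Z}^2}$ such that no two adjacent sites both carry the letter $1$. For a $\mathbb{Z}^d$ subshift $X$ (closed shift-invariant subset of $A^{\mathbb{Z}^d}$, $A$ a finite alphabet), $L_S(X)$ denotes the set of configurations on the shape $S$ that are restrictions of points of $X$, and the topological entropy is $h^{top}(X)=\lim_{j_1,\ldots,j_d\to\infty}\frac{\ln|L_{\prod_{i=1}^d[1,j_i]}(X)|}{j_1\cdots j_d}$ (the limit exists), where $[a,b]=\{a,a+1,\ldots,b\}$. For $n\ge1$, $H_n(\mathcal{H})$ is the set of configurations in $\{0,1\}^{\mathbb{Z}\times\{1,\ldots,n\}}$ in which no two adjacent sites both carry $1$. It is regarded as a $\mathbb{Z}$ nearest neighbor shift of finite type whose alphabet is the set of $n$-high columns in $\{0,1\}^{\{1,\ldots,n\}}$ with no two vertically adjacent $1$s, and $h^{top}(H_n(\mathcal{H}))$ is its topological entropy as a $\mathbb{Z}$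 subshift. *)

(* Defs.v *)
From HB Require Import structures.
From mathcomp Require Import all_boot all_order all_algebra finmap.
From mathcomp Require Import all_classical all_reals all_analysis.
Import Order.TTheory GRing.Theory Num.Theory.
Import numFieldNormedType.Exports.

Set Implicit Arguments.
Unset Strict Implicit.
Unset Printing Implicit Defensive.

Local Open Scope classical_set_scope.
Local Open Scope ring_scope.

Definition site (d : nat) := 'rV[int]_d.

Definition adjacent_sites (d : nat) (u v : site d) : bool :=
  \sum_(i < d) `|u 0 i - v 0 i| == 1.

Definition config (d : nat) (A : Type) := site d -> A.

Definition restriction (d : nat) (A : finType) (S : {fset site d})
    (x : config d A) : {ffun S -> A} :=
  [ffun s : S => x (val s)].

Definition language (d : nat) (A : finType) (S : {fset site d})
    (X : set (config d A)) : {set {ffun S -> A}} :=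
  [set p | `[< exists2 x, X x & restriction S x = p >]]%SET.

(* The box [1, j_1] x ... x [1, j_d]; see in_box. *)
Definition box (d : nat) (j : 'I_d -> nat) : {fset site d} :=
  [fset v in codom (fun k : {dffun forall i : 'I_d, 'I_(j i)} =>
                      \row_i (k i).+1%:Z : site d)]%fset.

Lemma in_box (d : nat) (j : 'I_d -> nat) (v : site d) :
  (v \in box j) = [forall i, 1 <= v 0 i <= (j i)%:Z].
Proof.
rewrite !inE /=; apply/codomP/forallP => [[k ->] i|vj].
  by rewrite mxE !lez_nat; exact: ltn_ord.
have v1 i : v 0 i = (`|v ord0 i|%N.-1).+1%:Z.
  by case/andP: (vj i); case: (v 0 i) => [[|m]|m].
have kj i : (`|v ord0 i|%N.-1 < j i)%N.
  by case/andP: (vj i) => _; rewrite {1}v1 lez_nat.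
exists [ffun i => Ordinal (kj i)].
by apply/rowP => i; rewrite mxE ffunE -v1.
Qed.

(* The filter of multi-indices all of whose coordinates tend to infinity
   (jointly, at independent speeds). *)
Definition multi_oo (d : nat) : set_system ('I_d -> nat) :=
  filter_from setT (fun N : nat => [set j | forall i, (N <= j i)%N]).

#[global] Instance multi_oo_proper (d : nat) : ProperFilter (@multi_oo d).
Proof.
apply: filter_from_proper; last by move=> N _; exists (fun=> N) => i /=.
apply: filter_from_filter; first by exists 0%N.
move=> M N _ _; exists (maxn M N) => // j jMN; split=> i /=;
  by apply: leq_trans (jMN i); rewrite ?leq_maxl ?leq_maxr.
Qed.

(* lim is total: for a subshift X the limit exists, elsewhere the value carries
   no meaning. *)
Definition htop (R : realType) (d : nat) (A : finType)
    (X : set (config d A)) : R :=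
  lim ((fun j : 'I_d -> nat =>
          ln (#|language (box j) X|%:R : R) / (\prod_(i < d) j i)%N%:R)
       @ @multi_oo d).

Definition hard_square : set (config 2 bool) :=
  [set x : config 2 bool | forall u v, adjacent_sites u v -> ~~ (x u && x v)].

(* Z x {1, ..., n} as a subset of Z^2; the index k : 'I_n stands for the row
   k + 1. *)
Definition strip_site (n : nat) (a : int) (k : 'I_n) : site 2 :=
  \row_(i < 2) if i == 0 then a else k.+1%:Z.

Definition strip_legal (n : nat) (y : int -> 'I_n -> bool) : Prop :=
  forall (a b : int) (k l : 'I_n),
    adjacent_sites (strip_site a k) (strip_site b l) -> ~~ (y a k && y b l).

Definition column_legal (n : nat) (c : {ffun 'I_n -> bool}) : bool :=
  [forall k, forall l,
     adjacent_sites (strip_site 0 k) (strip_site 0 l) ==> ~~ (c k && c l)].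

Definition column (n : nat) := {c : {ffun 'I_n -> bool} | column_legal c}.

(* H_n as a Z-subshift over the alphabet of legal columns: a sequence of
   columns, read as a configuration on the strip. *)
Definition strip_shift (n : nat) : set (config 1 (column n)) :=
  [set x : config 1 (column n) |
     strip_legal (fun a k => val (x (const_mx a)) k)].

(* Main.v *)
Require Import Defs.
From mathcomp Require Import all_boot all_order all_algebra finmap.
From mathcomp Require Import all_classical all_reals all_analysis.
From mathcomp Require Import ring lra zify.
Import Order.TTheory GRing.Theory Num.Theory.
Import numFieldNormedType.Exports.

(** Let [Z m n] be the number of independent sets of the [m * n] grid.  The words
    of length [m] of the strip shift of height [n], and the [m * n] patterns of
    the hard square shift, are both counted by [Z m n], so that everything follows
    from the behaviour of [logZ m n = ln (Z m n)].  The key estimate is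

      |logZ m n.+2 - 2 logZ m n.+1 + logZ m n| <= m ln 2 (7/8)^n

    ([logZ_second_diff]).  To prove it, the top row is added one site at a time
    to the grid of height [n.+1], and in parallel to the same grid without its
    bottom row.  Adding a site [v] divides the number of independent sets by the
    probability that [v] is vacant in a uniform independent set, so one has to
    compare the vacancy probabilities of [v] in two graphs which differ only at
    distance at least [n.+1] from [v].

    This is strong spatial mixing for the hard-core model of activity 1
    ([vac_decay]), and it follows from the tree recursion of Weitz: if [v] has
    neighbours [u_1], [u_2], ..., the probability that it is vacant is
    [1 / (1 + p_1 p_2 ...)], where [p_i] is the probability that [u_i] is vacant
    in the graph from which [v] and the [u_j] with [j < i] are deleted
    ([vac_rec]).  As [v] is deleted, only three neighbours are left to [u_i], and
    activity 1 is below the uniqueness threshold 27/16 of the tree with branching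
    number 3.  Concretely, two levels of the recursion contract the differences of
    logarithms of vacancy probabilities by 3/4, which comes down to
    [11 u v w <= 1 + 4 u v w (u + v + w)] ([contraction]).

    The rest is elementary.  A sequence with geometrically small second
    differences is affine up to a bounded error, and its increments converge
    exponentially fast.  As [logZ] is symmetric, this applies first to [m], where
    it shows that [logZ m n / m] tends to a number [d n], which is the entropy of
    the strip; the key estimate passes to [d], so that [d n.+1 - d n] converges
    exponentially fast to some [delta].  Both error terms being uniform,
    [logZ m n / (m n)] tends to [delta] when [m] and [n] go to infinity
    independently, that is, [delta] is the entropy of the hard square shift. *)

Set Implicit Arguments.
Unset Strict Implicit.
Unset Printing Implicit Defensive.

Local Open Scope classical_set_scope.
Local Open Scope fset_scope.
Local Open Scope ring_scope.

(** * Independent sets and vacancy probabilities *)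

Lemma in_fsetsep (T : choiceType) (A : {fset T}) (P : pred T) x :
  (x \in [fset y in A | P y]) = (x \in A) && P x.
Proof. by rewrite !inE. Qed.

Section Counting.
Variables (T : choiceType) (e : rel T).
Hypotheses (e_sym : symmetric e) (e_irr : irreflexive e).
Implicit Types (G I : {fset T}) (L : seq T).

Definition independent I : bool :=
  all (fun x => all (fun y => ~~ e x y) (enum_fset I)) (enum_fset I).

Lemma independentP I :
  reflect {in I &, forall x y, ~~ e x y} (independent I).
Proof.
apply: (iffP allP) => [h x y xI yI|h x xI]; first exact: (allP (h x xI)).
by apply/allP => y yI; apply: h.
Qed.

Lemma independentS I G : I `<=` G -> independent G -> independent I.
Proof.
move=> /fsubsetP IG /independentP h; apply/independentP => x y /IG xG /IG yG.
exact: h.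
Qed.

Definition indsets G : {fset {fset T}} :=
  [fset I in fpowerset G | independent I].

Lemma in_indsets G I : (I \in indsets G) = (I `<=` G) && independent I.
Proof. by rewrite !inE fpowersetE. Qed.

Definition nind G : nat := #|` indsets G|.

Lemma nind_gt0 G : (0 < nind G)%N.
Proof.
rewrite cardfs_gt0; apply/fset0Pn; exists fset0.
by rewrite in_indsets fsub0set; apply/independentP => x y; rewrite inE.
Qed.

Lemma nindS G H : G `<=` H -> (nind G <= nind H)%N.
Proof.
move=> GH; apply: fsubset_leq_card; apply/fsubsetP => I.
by rewrite !in_indsets => /andP[IG ->]; rewrite (fsubset_trans IG GH).
Qed.

Definition remove G L : {fset T} := [fset x in G | x \notin L].

Lemma in_remove G L x : (x \in remove G L) = (x \in G) && (x \notin L).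
Proof. exact: in_fsetsep. Qed.

Lemma remove_sub G L : remove G L `<=` G.
Proof. by apply/fsubsetP => x; rewrite in_remove => /andP[]. Qed.

(** The hard-core recursion: an independent set either misses [v], or it is [v]
    together with an independent set avoiding [v] and its neighbours.  [L] may
    contain neighbours of [v] outside [G], so that one list can serve for two
    different graphs. *)
Lemma nind_rec G v L : v \in G -> all (e v) L ->
  {in G, forall w, e v w -> w \in L} ->
  nind G = (nind (G `\ v) + nind (remove (G `\ v) L))%N.
Proof.
move=> vG /allP vL LG.
have inj : {in indsets (remove (G `\ v) L) &, injective (fun I => v |` I)}.
  move=> I J; rewrite !in_indsets => /andP[/fsubsetP IG _] /andP[/fsubsetP JG _].
  have vI : v \notin I by apply/negP => /IG; rewrite in_remove !inE eqxx.
  have vJ : v \notin J by apply/negP => /JG; rewrite in_remove !inE eqxx.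
  by move=> IJ; rewrite -(fsetU1K vI) IJ fsetU1K.
rewrite [nind (remove _ _)](_ : _ = #|` [fset v |` I | I in
    indsets (remove (G `\ v) L)]|%fset); last by rewrite card_in_imfset.
rewrite /nind.
have dis : [disjoint indsets (G `\ v) &
    [fset v |` I | I in indsets (remove (G `\ v) L)]]%fset.
  apply/fdisjointP => I; rewrite in_indsets => /andP[/fsubsetP IG _].
  apply/negP => /imfsetP[J _ IJ].
  by have /IG : v \in I; rewrite ?IJ !inE eqxx.
move: dis; rewrite -fsetI_eq0 => /eqP dis.
rewrite -cardfsUI dis cardfs0 addn0; congr #|` _|.
apply/fsetP => I; rewrite in_fsetU !in_indsets.
have [vI|vI] := boolP (v \in I); last first.
  have -> : (I `<=` G `\ v) = (I `<=` G) by rewrite fsubsetD1 vI andbT.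
  case: (X in X || _) => //=; apply/esym/negbTE/negP.
  by move=> /imfsetP[J _ IJ]; case/negP: vI; rewrite IJ !inE eqxx.
have -> : (I `<=` G `\ v) = false by rewrite fsubsetD1 vI andbF.
rewrite /=; apply/andP/imfsetP => [[IG indI]|[J + ->]]; last first.
  rewrite /= in_indsets => /andP[/fsubsetP JG /independentP indJ]; split.
    apply/fsubsetP => x /fset1UP[->//|/JG].
    by rewrite in_remove !inE => /andP[/andP[]].
  have vJ x : x \in J -> ~~ e v x.
    move=> /JG; rewrite in_remove !inE => /andP[/andP[_ xG] xL].
    by apply: contra xL; apply: LG.
  apply/independentP => x y /fset1UP[->|xJ] /fset1UP[->|yJ].
  - by rewrite e_irr.
  - exact: vJ.
  - by rewrite e_sym vJ.
  - exact: indJ.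
exists (I `\ v); last by rewrite fsetD1K.
rewrite /= in_indsets (independentS (fsubD1set _ _) indI) andbT.
apply/fsubsetP => x; rewrite in_remove !inE => /andP[-> xI] /=.
rewrite (fsubsetP IG) //=; apply/negP => /vL.
by apply/negP; apply: (independentP _ indI).
Qed.

Section Vacancy.
Variable R : realType.

(** The probability that [v] is vacant in a uniform independent set of [G]. *)
Definition vac G v : R := (nind (G `\ v))%:R / (nind G)%:R.

(** The probability that all of [L] is vacant, written by the chain rule:
    conditioning on a vacant vertex amounts to deleting it. *)
Fixpoint vacs G L : R :=
  if L is u :: L' then vac G u * vacs (G `\ u) L' else 1.

Lemma nindR_gt0 G : 0 < (nind G)%:R :> R.
Proof. by rewrite ltr0n nind_gt0. Qed.

Lemma vac_notin G v : v \notin G -> vac G v = 1.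
Proof.
move=> vG; rewrite /vac (_ : G `\ v = G) ?divff ?gt_eqF ?nindR_gt0//.
by apply/fsetP => x; rewrite !inE; case: eqP => // ->; rewrite (negbTE vG).
Qed.

Lemma vacs_remove G L : vacs G L = (nind (remove G L))%:R / (nind G)%:R.
Proof.
elim: L G => [|u L IH] G /=.
  rewrite (_ : remove G [::] = G) ?divff ?gt_eqF ?nindR_gt0//.
  by apply/fsetP => x; rewrite in_remove andbT.
rewrite IH /vac (_ : remove (G `\ u) L = remove G (u :: L)).
  have := nindR_gt0 (G `\ u); have := nindR_gt0 G => h1 h2.
  by field; rewrite !gt_eqF.
by apply/fsetP => x; rewrite !in_remove !inE negb_or; do !case: (_ \in _) => //;
  rewrite ?andbT ?andbF.
Qed.

(** The recursion that replaces the graph by its tree of self-avoiding walks: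
    each factor of [vacs (G `\ v) L] is the vacancy probability of a neighbour
    of [v] in a graph from which [v] has been deleted, hence in which this
    neighbour has one neighbour less. *)
Lemma vac_rec G v L : v \in G -> all (e v) L ->
  {in G, forall w, e v w -> w \in L} ->
  vac G v = (1 + vacs (G `\ v) L)^-1.
Proof.
move=> vG vL LG; rewrite /vac (nind_rec vG vL LG) vacs_remove natrD.
have h1 := nindR_gt0 (G `\ v); have h2 := nindR_gt0 (remove (G `\ v) L).
by field; rewrite !gt_eqF// addr_gt0.
Qed.

Definition nbrs G v := [seq w <- enum_fset G | e v w].

Lemma vac_le1 G v : vac G v <= 1.
Proof.
rewrite /vac ler_pdivrMr ?nindR_gt0// mul1r ler_nat nindS//.
exact: fsubD1set.
Qed.

Lemma vac_gt0 G v : 0 < vac G v.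
Proof. by rewrite divr_gt0// nindR_gt0. Qed.

Lemma vacs_gt0 G L : 0 < vacs G L.
Proof. by elim: L G => [|u L IH] G //=; rewrite mulr_gt0// vac_gt0. Qed.

Lemma vac_ge0 G v : 0 <= vac G v.
Proof. exact/ltW/vac_gt0. Qed.

Lemma vacs_ge0 G L : 0 <= vacs G L.
Proof. exact/ltW/vacs_gt0. Qed.

Lemma vac_ge_half G v : 1 <= 2 * vac G v.
Proof.
have [vG|vG] := boolP (v \in G); last by rewrite vac_notin//; lra.
rewrite /vac mulrA ler_pdivlMr ?nindR_gt0// mul1r -natrM ler_nat.
rewrite (@nind_rec G v (nbrs G v))// ?filter_all// ?mul2n -?addnn.
  by rewrite leq_add2l nindS// remove_sub.
by move=> w wG vw; rewrite mem_filter vw.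
Qed.

End Vacancy.

End Counting.

(** * Contraction of two levels of the recursion *)

Section Contraction.
Variable R : realType.
Implicit Types (u v w x y z s : R).

Lemma agm_cubic u v w : 0 <= u -> 0 <= v -> 0 <= w ->
  27 * (u * v * w) <= (u + v + w) ^+ 3.
Proof.
move=> u0 v0 w0.
have h1 : 0 <= u * (v - w) ^+ 2 by rewrite mulr_ge0// sqr_ge0.
have h2 : 0 <= v * (u - w) ^+ 2 by rewrite mulr_ge0// sqr_ge0.
have h3 : 0 <= w * (u - v) ^+ 2 by rewrite mulr_ge0// sqr_ge0.
have h4 : 0 <= (u + v + w) * ((u - v) ^+ 2 + (v - w) ^+ 2 + (u - w) ^+ 2).
  by rewrite mulr_ge0// ?addr_ge0// ?sqr_ge0.
lra.
Qed.

(** This is where the activity 1 and the branching number 3 enter.  When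
    [u = v = w] the inequality reads [11 g^3 <= 1 + 12 g^4]; the general case
    reduces to a quartic in the sum, through the inequality of arithmetic and
    geometric means. *)
Lemma contraction_poly u v w : 0 <= u -> 0 <= v -> 0 <= w ->
  11 * (u * v * w) <= 1 + 4 * (u * v * w) * (u + v + w).
Proof.
move=> u0 v0 w0; have := agm_cubic u0 v0 w0.
have t0 : 0 <= u * v * w by rewrite !mulr_ge0.
have : 0 <= u + v + w by rewrite !addr_ge0.
move: (u * v * w) t0 (u + v + w) => t t0 S S0 tS.
(* For [4 S < 11] the bound [t <= S^3 / 27] leaves [0 <= 27 - 11 S^3 + 4 S^4];
   the first square below is chosen so that the rest is a positive quadratic. *)
have [S11|S11] := lerP 11 (4 * S).
  have := mulr_ge0 t0 (_ : 0 <= 4 * S - 11).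
  by rewrite subr_ge0 S11 => /(_ isT); lra.
have : t * (11 - 4 * S) * 27 <= S ^+ 3 * (11 - 4 * S).
  have := ler_wpM2r (_ : 0 <= 11 - 4 * S) tS.
  by rewrite subr_ge0 ltW// => /(_ isT); lra.
have := sqr_ge0 (2 * S ^+ 2 - 11 / 4 * S - 5 / 2).
have := sqr_ge0 (S - 110 / 39).
lra.
Qed.

(** The product of the vacancy probabilities of three neighbours whose occupation
    odds are [s x], [s y] and [s z]. *)
Definition vac3 x y z s := ((1 + s * x) * (1 + s * y) * (1 + s * z))^-1.

(** Multiplying the odds two levels below by [s] multiplies the vacancy
    probability [1 / (1 + vac3 x y z s)] of the root by at most [s^(1/4)]: the
    function [s (1 + vac3 x y z s)^4] is nondecreasing, its derivative having the
    sign of the polynomial of [contraction_poly] at [1 / (1 + s x)],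
    [1 / (1 + s y)] and [1 / (1 + s z)]. *)
Lemma vac3_contraction x y z s : 0 <= x -> 0 <= y -> 0 <= z -> 1 <= s ->
  (1 + vac3 x y z 1) ^+ 4 <= s * (1 + vac3 x y z s) ^+ 4.
Proof.
move=> x0 y0 z0 s1.
pose f s := s * (1 + vac3 x y z s) ^+ 4.
have sx0 (t : R) a : 0 < t -> 0 <= a -> 0 < 1 + t * a.
  by move=> t0 a0; rewrite ltr_pwDl// mulr_ge0// ltW.
have C0 (t : R) : 0 < t -> (1 + t * x) * (1 + t * y) * (1 + t * z) != 0.
  by move=> t0; rewrite gt_eqF// !mulr_gt0// sx0.
pose df t := (1 + vac3 x y z t) ^+ 3 *
   (1 + vac3 x y z t - 4 * vac3 x y z t *
     (3 - ((1 + t * x)^-1 + (1 + t * y)^-1 + (1 + t * z)^-1))).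
have fE (t : R) : 0 < t -> is_derive t (1 : R) (f : R -> R) (df t).
  move=> t0; rewrite /f /vac3; have := C0 _ t0 => CN.
  apply: is_derive_eq.
  rewrite /df /vac3 !scaler1 /GRing.scale /=.
  field.
  by rewrite !gt_eqF ?sx0.
have [->|s_neq1] := eqVneq s 1; first by rewrite mul1r.
have lt1s : 1 < s by rewrite lt_neqAle eq_sym s_neq1.
have fE' t : t \in `]1, s[%R -> is_derive t (1 : R) (f : R -> R) (df t).
  by rewrite in_itv /= => /andP[t1 _]; apply: fE; apply: lt_trans t1.
have cf : {within `[1, s], continuous (f : R -> R)}%classic.
  apply: derivable_within_continuous => t; rewrite in_itv /= => /andP[t1 _].
  have t0 : 0 < t by apply: lt_le_trans t1.
  by case: (fE t t0).
have [t + fst] := MVT lt1s fE' cf.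
rewrite in_itv /= => /andP[t1 _].
have t0 : 0 < t by apply: lt_trans t1.
rewrite -[leLHS]mul1r -/(f 1) -/(f s) -subr_ge0 fst mulr_ge0 ?subr_ge0//.
have u0 a : 0 <= a -> 0 <= (1 + t * a)^-1.
  by move=> a0; rewrite invr_ge0 ltW ?sx0.
have := contraction_poly (u0 x x0) (u0 y y0) (u0 z z0).
rewrite /df /vac3 !invfM => ineq.
by apply: mulr_ge0; [rewrite exprn_ge0 ?addr_ge0 ?mulr_ge0 ?u0 | lra].
Qed.

(** The form used on graphs, with vacancy probabilities [p_i] and [q_i] instead
    of odds.  Fewer than three neighbours are handled by putting [p_i = q_i = 1]. *)
Lemma contraction (p1 p2 p3 q1 q2 q3 s : R) :
  0 < p1 <= 1 -> 0 < p2 <= 1 -> 0 < p3 <= 1 ->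
  0 < q1 -> 0 < q2 -> 0 < q3 -> 1 <= s ->
  q1^-1 - 1 <= s * (p1^-1 - 1) -> q2^-1 - 1 <= s * (p2^-1 - 1) ->
  q3^-1 - 1 <= s * (p3^-1 - 1) ->
  (1 + p1 * p2 * p3) ^+ 4 <= s * (1 + q1 * q2 * q3) ^+ 4.
Proof.
move=> P1 P2 P3 q1_gt0 q2_gt0 q3_gt0 s1 h1 h2 h3.
have odds_ge0 (p : R) : 0 < p <= 1 -> 0 <= p^-1 - 1.
  by case/andP=> p0 p1'; rewrite subr_ge0 invf_ge1.
have s0 : 0 < s by apply: lt_le_trans s1.
have vac_le (p q : R) : 0 < p <= 1 -> 0 < q -> q^-1 - 1 <= s * (p^-1 - 1) ->
    (1 + s * (p^-1 - 1))^-1 <= q.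
  move=> P q0 h; rewrite -[leRHS]invrK lef_pV2 ?posrE ?invr_gt0//.
    by rewrite -lerBlDl.
  by rewrite ltr_pwDl// mulr_ge0 ?odds_ge0 // ltW.
have := vac3_contraction (odds_ge0 _ P1) (odds_ge0 _ P2) (odds_ge0 _ P3) s1.
rewrite /vac3 !mul1r !(addrC 1) !subrK !invfM !invrK => /le_trans; apply.
have vac_ge0 (p : R) : 0 < p <= 1 -> 0 <= (s * (p^-1 - 1) + 1)^-1.
  by move=> P; rewrite invr_ge0 addr_ge0// mulr_ge0 ?odds_ge0 ?(ltW s0).
rewrite ler_pM2l// lerXn2r ?nnegrE ?addr_ge0 ?mulr_ge0 ?vac_ge0 ?(ltW q1_gt0)
  ?(ltW q2_gt0) ?(ltW q3_gt0)// lerD2r.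
by rewrite !ler_pM ?mulr_ge0 ?vac_ge0// addrC vac_le.
Qed.

End Contraction.

(** * Strong spatial mixing *)

Section Decay.
Variables (R : realType) (T : choiceType) (e : rel T) (rho : T -> nat).
Hypotheses (e_sym : symmetric e) (e_irr : irreflexive e).
Hypothesis degree_le4 : forall v s, uniq s -> all (e v) s -> (size s <= 4)%N.
Hypothesis rho_lip : forall u v, e u v -> (rho u <= (rho v).+1)%N.
Implicit Types (G H : {fset T}) (L : seq T) (u v w : T).
Local Notation vac := (vac e R).
Local Notation vacs := (vacs e R).
Local Notation nbrs := (nbrs e).

(** Two graphs may differ only where [rho] vanishes; since [rho] is 1-Lipschitz,
    a vertex [v] is then at distance at least [rho v] from the difference. *)
Definition agree G H : Prop := forall x, (0 < rho x)%N -> (x \in G) = (x \in H).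

Lemma agreeD1 G H u : agree G H -> agree (G `\ u) (H `\ u).
Proof. by move=> GH x x0; rewrite !inE GH. Qed.

Lemma size_nbrs_le3 G u v : e v u -> u \notin G -> (size (nbrs G v) <= 3)%N.
Proof.
move=> vu uG; have := @degree_le4 v (u :: nbrs G v); apply.
  by rewrite /= mem_filter (negbTE uG) andbF filter_uniq.
by rewrite /= vu filter_all.
Qed.

Lemma nbrs_all G v : all (e v) (nbrs G v).
Proof. exact: filter_all. Qed.

Lemma nbrs_superset G H v : G `<=` H ->
  {in G, forall w, e v w -> w \in nbrs H v}.
Proof. by move=> /fsubsetP GH w /GH wH vw; rewrite mem_filter vw. Qed.

(** The factor 3/4 per two levels: a factor [expR x] on the vacancy probabilities
    of at most three vertices gives a factor [expR (3 x)] on the odds of their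
    common parent, and [contraction] takes the fourth root. *)
Definition rate k : R := (3 / 4) ^+ k * ln 2.

Lemma rate_ge0 k : 0 <= rate k.
Proof. by rewrite mulr_ge0 ?exprn_ge0 ?ln_ge0 ?divr_ge0// ler1n. Qed.

(** The bound on the number of neighbours is what makes the contraction work; it
    propagates along the recursion because a vertex is examined only after one
    of its at most four neighbours has been deleted. *)
Definition decays k := forall G H v, agree G H -> (k.*2 <= rho v)%N ->
  (size (nbrs (G `|` H) v) <= 3)%N -> vac H v <= expR (rate k) * vac G v.

Lemma vacs_decay k G H u L : decays k -> agree G H -> (k.*2 < rho u)%N ->
  u \notin G -> u \notin H -> all (e u) L ->
  vacs H L <= expR (rate k *+ size L) * vacs G L.
Proof.
move=> IH; elim: L G H => [|w L IHL] G H GH ku uG uH /=.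
  by rewrite expR0 mul1r.
move=> /andP[uw uL].
rewrite mulrS expRD mulrACA ler_pM ?vac_ge0 ?vacs_ge0//.
  apply: IH => //; first by have := rho_lip uw; lia.
  by apply: (@size_nbrs_le3 _ u); rewrite ?[e w u]e_sym// inE negb_or uG.
apply: IHL => //; first exact: agreeD1.
- by rewrite !inE negb_and uG orbT.
- by rewrite !inE negb_and uH orbT.
Qed.

(** The occupation odds [(vac G u)^-1 - 1] of a child [u] of [v] are, by [vac_rec],
    a product of at most three vacancy probabilities one level below, whence the
    exponent 3. *)
Lemma odds_decay k G H u v : decays k -> agree G H -> (k.*2.+1 < rho v)%N ->
  v \notin G -> v \notin H -> e v u ->
  (vac H u)^-1 - 1 <= expR (rate k *+ 3) * ((vac G u)^-1 - 1).
Proof.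
move=> IH GH kv vG vH vu.
have ku : (k.*2 < rho u)%N by have := rho_lip vu; lia.
have [uG|uG] := boolP (u \in G); last first.
  have uH : u \notin H by rewrite -GH// (leq_ltn_trans _ ku).
  by rewrite !vac_notin// !invr1 subrr mulr0.
have uH : u \in H by rewrite -GH// (leq_ltn_trans _ ku).
have e_uL := nbrs_all (G `|` H) u.
rewrite (@vac_rec _ _ e_sym e_irr _ H u _ uH e_uL); last first.
  exact/nbrs_superset/fsubsetUr.
rewrite (@vac_rec _ _ e_sym e_irr _ G u _ uG e_uL); last first.
  exact/nbrs_superset/fsubsetUl.
rewrite !invrK !(addrC 1) !addrK.
apply: le_trans (vacs_decay IH (agreeD1 u GH) ku _ _ e_uL) _;
  rewrite ?fsetD11//.
rewrite ler_wpM2r ?vacs_ge0// ler_expR ler_wpMn2l ?rate_ge0//.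
by apply: (@size_nbrs_le3 _ v); rewrite ?[e u v]e_sym// inE negb_or vG.
Qed.

(** Strong spatial mixing: the influence of a distant change of the graph on the
    vacancy probability of [v] decays exponentially.  The induction descends two
    levels at a time, because one level of the recursion need not contract; it
    starts from the fact that a vacancy probability lies between 1/2 and 1. *)
Lemma vac_decay k : decays k.
Proof.
elim: k => [|k IH] G H v GH kv dv.
  rewrite /rate expr0 mul1r lnK ?posrE//.
  by rewrite (le_trans (vac_le1 _ _ _ _))// vac_ge_half.
have v0 : (0 < rho v)%N by apply: leq_trans kv.
have [vG|vG] := boolP (v \in G); last first.
  by rewrite !vac_notin// -?GH// mulr1 -expR0 ler_expR rate_ge0.
have vH : v \in H by rewrite -GH.
have evL := nbrs_all (G `|` H) v.
rewrite (@vac_rec _ _ e_sym e_irr _ H v _ vH evL); last first.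
  exact/nbrs_superset/fsubsetUr.
rewrite (@vac_rec _ _ e_sym e_irr _ G v _ vG evL); last first.
  exact/nbrs_superset/fsubsetUl.
have V0 G' L : 0 < 1 + vacs G' L by rewrite addr_gt0 ?vacs_gt0.
rewrite -[leRHS]invrK invfM invrK lef_pV2 ?posrE ?divr_gt0 ?expR_gt0//; last first.
  by rewrite mulr_gt0// invr_gt0 expR_gt0.
rewrite mulrC ler_pdivrMr ?expR_gt0// mulrC.
rewrite -(@ler_pXn2r _ 4) ?nnegrE ?mulr_ge0 ?expR_ge0 ?(ltW (V0 _ _))//.
rewrite exprMn -expRM_natl mulr_natl (_ : rate k.+1 *+ 4 = rate k *+ 3); last first.
  by rewrite /rate exprS -mulrA; move: (_ * ln 2) => r; lra.
have s1 : 1 <= expR (rate k *+ 3).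
  by rewrite -expR0 ler_expR mulrn_wge0// rate_ge0.
have vGD : v \notin G `\ v by rewrite fsetD11.
have vHD : v \notin H `\ v by rewrite fsetD11.
have odds := odds_decay IH _ kv _ _ _.
have P1 G' u : 0 < vac G' u <= 1 by rewrite vac_gt0 vac_le1.
have one : 0 < (1 : R) <= 1 by rewrite ltr01 /=.
have triv : (1 : R)^-1 - 1 <= expR (rate k *+ 3) * (1^-1 - 1).
  by rewrite invr1 subrr mulr0.
have GHv := agreeD1 v GH.
have nD (A : {fset T}) u : v \notin A -> v \notin A `\ u.
  by move=> vA; rewrite !inE negb_and vA orbT.
case: (nbrs _ _) dv evL => [|u1 [|u2 [|u3 [|]]]]//= _; rewrite ?andbT.
- move=> _; have := contraction one one one ltr01 ltr01 ltr01 s1 triv triv triv.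
  by rewrite !mulr1.
- move=> vu1; have := contraction (P1 (G `\ v) u1) one one (vac_gt0 e R (H `\ v) u1)
    ltr01 ltr01 s1 (odds _ _ _ GHv vGD vHD vu1) triv triv.
  by rewrite !mulr1.
- case/andP=> vu1 vu2.
  have := contraction (P1 (G `\ v) u1) (P1 (G `\ v `\ u1) u2) one
    (vac_gt0 e R (H `\ v) u1) (vac_gt0 e R (H `\ v `\ u1) u2) ltr01 s1
    (odds _ _ _ GHv vGD vHD vu1)
    (odds _ _ _ (agreeD1 u1 GHv) (nD _ _ vGD) (nD _ _ vHD) vu2) triv.
  by rewrite !mulr1.
case/and3P=> vu1 vu2 vu3; rewrite !mulr1 ![_ * (vac _ u2 * vac _ u3)]mulrA.
apply: contraction; rewrite ?P1 ?vac_gt0//; apply: odds => //.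
- exact: agreeD1.
- exact: nD.
- exact: nD.
- by do 2!apply: agreeD1.
- by apply: (nD); apply: nD.
- by apply: (nD); apply: nD.
Qed.

End Decay.

(** * Rectangles in the square lattice *)

Lemma nind_imfset (T : choiceType) (e : rel T) (f : T -> T) (G : {fset T}) :
  injective f -> {mono f : x y / e x y} -> nind e (f @` G) = nind e G.
Proof.
move=> f_inj f_mono; rewrite /nind.
pose im (I : {fset T}) := f @` I.
have im_inj : injective im.
  move=> I J /fsetP IJ; apply/fsetP => x.
  by have := IJ (f x); rewrite !mem_imfset.
rewrite (_ : #|` indsets e G| = #|` [fset im I | I in indsets e G]|);
  last by rewrite (card_imfset _ _ im_inj).
congr #|` _|; apply/fsetP => I; rewrite in_indsets; apply/andP/imfsetP.
  move=> [/fsubsetP IG /independentP indI].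
  exists [fset x in G | f x \in I]; last first.
    apply/fsetP => y; apply/idP/imfsetP => [yI|[x + ->]]; last first.
      by rewrite !inE => /andP[].
    have /imfsetP[x xG yE] := IG _ yI.
    by exists x; rewrite // in_fsetsep -yE yI andbT.
  rewrite /= in_indsets fset_sub; apply/independentP => x y.
  by rewrite !inE => /andP[_ xI] /andP[_ yI]; rewrite -f_mono indI.
move=> [J /=]; rewrite in_indsets => /andP[/fsubsetP JG /independentP indJ] ->.
split; first by apply/fsubsetP => _ /imfsetP[x /JG xG ->]; rewrite in_imfset.
apply/independentP => _ _ /imfsetP[x xJ ->] /imfsetP[y yJ ->].
by rewrite f_mono indJ.
Qed.

Definition adj (u v : nat * nat) : bool :=
  ((u.1 == v.1) && ((u.2.+1 == v.2) || (v.2.+1 == u.2))) ||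
  ((u.2 == v.2) && ((u.1.+1 == v.1) || (v.1.+1 == u.1))).

Lemma adj_sym : symmetric adj.
Proof. by move=> [a b] [c d]; rewrite /adj /=; apply/idP/idP; lia. Qed.

Lemma adj_irr : irreflexive adj.
Proof. by move=> [a b]; rewrite /adj /=; lia. Qed.

Lemma adj_degree_le4 v s : uniq s -> all (adj v) s -> (size s <= 4)%N.
Proof.
move=> us /allP vs.
apply: (@uniq_leq_size _ s
  [:: (v.1.+1, v.2); (v.1.-1, v.2); (v.1, v.2.+1); (v.1, v.2.-1)]) => //.
move=> [a b] /vs; case: v {vs} => c d; rewrite /adj !inE !xpair_eqE /=; lia.
Qed.

Lemma adj_row u v : adj u v -> (u.2 <= v.2.+1)%N.
Proof. by case: u v => a b [c d]; rewrite /adj /=; lia. Qed.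

Definition rect m n : {fset nat * nat} :=
  [fset x in [seq (i, j) | i <- iota 0 m, j <- iota 0 n]].

Lemma in_rect m n x : (x \in rect m n) = (x.1 < m)%N && (x.2 < n)%N.
Proof.
rewrite !inE /=; apply/allpairsP/andP => [[[i j] /=]|[xm xn]].
  by rewrite !mem_iota !add0n /= => -[im jn ->].
by exists x; rewrite !mem_iota /= xm xn; case: x {xm xn}.
Qed.

(** Interpolates between the rectangles of heights [n.+1] and [n.+2], adding the
    sites of the top row one at a time. *)
Definition staircase m n i : {fset nat * nat} :=
  [fset x in rect m n.+2 | (x.2 <= n)%N || (x.1 < i)%N].

Lemma in_staircase m n i x : (x \in staircase m n i) =
  (x.1 < m)%N && (x.2 < n.+2)%N && ((x.2 <= n)%N || (x.1 < i)%N).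
Proof. by rewrite in_fsetsep in_rect. Qed.

Definition drop_row0 (G : {fset nat * nat}) : {fset nat * nat} :=
  [fset x in G | (0 < x.2)%N].

Lemma in_drop_row0 G x : (x \in drop_row0 G) = (x \in G) && (0 < x.2)%N.
Proof. exact: in_fsetsep. Qed.

Section Grid.
Variable R : realType.

Definition lognind (G : {fset nat * nat}) : R := ln (nind adj G)%:R.

Lemma lognind_vac G v : lognind G = lognind (G `\ v) - ln (vac adj R G v).
Proof.
rewrite /lognind /vac ln_div ?posrE ?nindR_gt0//; lra.
Qed.

Definition logZ m n : R := lognind (rect m n).

Lemma logZC m n : logZ m n = logZ n m.
Proof.
rewrite /logZ /lognind -(@nind_imfset _ adj (fun x => (x.2, x.1)) (rect m n)).
- congr (ln (nind _ _)%:R); apply/fsetP => x.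
  rewrite in_rect; apply/imfsetP/andP => [[y]|[xn xm]].
    by rewrite /= in_rect => /andP[? ?] -> /=.
  by exists (x.2, x.1); [rewrite /= in_rect /= xn xm | case: x {xn xm}].
- by move=> [a b] [c d] /= [-> ->].
- by move=> [a b] [c d]; rewrite /adj /= orbC.
Qed.

Lemma logZ_drop_row0 m n : lognind (drop_row0 (rect m n.+1)) = logZ m n.
Proof.
rewrite /logZ /lognind -(@nind_imfset _ adj (fun x => (x.1, x.2.+1)) (rect m n)).
- congr (ln (nind _ _)%:R); apply/fsetP => x.
  case: x => a b; rewrite in_drop_row0 in_rect /=; apply/idP/imfsetP => [h|[y +]].
    by exists (a, b.-1); [rewrite /= in_rect /=|congr (_, _)]; rewrite /=; lia.
  by case: y => c d; rewrite /= in_rect /= => h [-> ->]; lia.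
- by move=> [a b] [c d] /= [-> ->].
- by move=> [a b] [c d]; rewrite /adj /=; apply/idP/idP; lia.
Qed.

Lemma rect0 n : rect 0 n = fset0.
Proof. by apply/fsetP => x; rewrite in_rect inE. Qed.

Lemma logZ0 n : logZ 0 n = 0.
Proof.
rewrite /logZ rect0 /lognind (_ : nind adj fset0 = 1%N) ?ln1//.
rewrite -(cardfs1 (fset0 : {fset nat * nat})); congr #|` _|.
apply/fsetP => I; rewrite in_indsets inE fsubset0; case: eqP => //= ->.
by apply/independentP => x; rewrite inE.
Qed.

(** The last site of the staircase has at most two neighbours, and it lies in row
    [n.+1], at distance [n.+1] from the bottom row.  Since [3 / 4 <= (7 / 8)^2],
    the rate per two rows is absorbed in [7 / 8] per row. *)
Lemma log_vac_decay m n i : (i < m)%N ->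
  `|ln (vac adj R (staircase m n i.+1) (i, n.+1)) -
    ln (vac adj R (drop_row0 (staircase m n i.+1)) (i, n.+1))|
  <= ln 2 * (7 / 8) ^+ n.
Proof.
move=> im.
set G := staircase _ _ _; set H := drop_row0 G; set v := (i, n.+1).
pose k := n.+1./2.
have rate_le : rate R k <= ln 2 * (7 / 8) ^+ n.
  rewrite /rate mulrC ler_wpM2l ?ln_ge0 ?ler1n//.
  have k2n : (n <= k.*2)%N by rewrite /k; lia.
  apply: (@le_trans _ _ ((7 / 8) ^+ k.*2)).
    rewrite -mul2n exprM; apply: lerXn2r; rewrite ?nnegrE ?exprn_ge0 ?divr_ge0//.
    by rewrite expr2; lra.
  by apply: ler_wiXn2l => //; lra.
have kv : (k.*2 <= v.2)%N by rewrite /k /v /=; lia.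
have agGH : agree snd G H.
  by move=> x x0; rewrite in_drop_row0 x0 andbT.
have agHG : agree snd H G by move=> x /agGH.
have HG : H `<=` G by apply: fset_sub.
have GHU : G `|` H = G by apply/fsetUidPl.
have HGU : H `|` G = G by apply/fsetUidPr.
have dv : (size (nbrs adj G v) <= 3)%N.
  apply: (@leq_trans (size [:: (i.-1, n.+1); (i, n)])) => //.
  apply: uniq_leq_size; first by rewrite filter_uniq.
  move=> [a b]; rewrite mem_filter in_staircase /adj !inE !xpair_eqE /=; lia.
have h := @vac_decay R _ adj snd adj_sym adj_irr adj_degree_le4 adj_row k.
have h1 := h G H v agGH kv; rewrite GHU in h1.
have h2 := h H G v agHG kv; rewrite HGU in h2.
have lnle x y : 0 < x -> 0 < y -> x <= expR (rate R k) * y ->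
    ln x - ln y <= ln 2 * (7 / 8) ^+ n.
  move=> x0 y0; rewrite -ler_ln ?posrE ?mulr_gt0 ?expR_gt0//.
  by rewrite lnM ?posrE ?expR_gt0// expRK; lra.
have := lnle _ _ (vac_gt0 adj R H v) (vac_gt0 adj R G v) (h1 dv).
have := lnle _ _ (vac_gt0 adj R G v) (vac_gt0 adj R H v) (h2 dv).
by rewrite ler_norml; lra.
Qed.

Lemma staircaseD1 m n i : (i < m)%N ->
  staircase m n i.+1 `\ (i, n.+1) = staircase m n i.
Proof.
move=> im; apply/fsetP => -[a b].
by rewrite in_fsetD1 !in_staircase xpair_eqE /=; lia.
Qed.

(** Each added site changes the logarithmic counts of the staircase and of the
    staircase without its bottom row by the logarithms of two vacancy
    probabilities that nearly coincide. *)
Lemma staircase_diff m n i : (i <= m)%N ->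
  `|(lognind (staircase m n i) - lognind (staircase m n 0)) -
    (lognind (drop_row0 (staircase m n i)) - lognind (drop_row0 (staircase m n 0)))|
  <= i%:R * (ln 2 * (7 / 8) ^+ n).
Proof.
elim: i => [_|i IH im]; first by rewrite !subrr normr0 mul0r.
rewrite (lognind_vac (staircase m n i.+1) (i, n.+1)).
rewrite (lognind_vac (drop_row0 _) (i, n.+1)) staircaseD1//.
rewrite (_ : _ `\ _ = drop_row0 (staircase m n i)); last first.
  apply/fsetP => x; rewrite in_fsetD1 !in_drop_row0.
  by rewrite -(staircaseD1 n im) in_fsetD1 andbA.
have := IH (ltnW im); have := log_vac_decay n im.
rewrite -[i.+1]addn1 natrD mulrDl mul1r !ler_norml; lra.
Qed.

Lemma logZ_second_diff m n :
  `|logZ m n.+2 - 2 * logZ m n.+1 + logZ m n| <= m%:R * (ln 2 * (7 / 8) ^+ n).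
Proof.
have := staircase_diff n (leqnn m).
have -> : staircase m n 0 = rect m n.+1.
  by apply/fsetP => x; rewrite in_staircase in_rect; lia.
have -> : staircase m n m = rect m n.+2.
  by apply/fsetP => x; rewrite in_staircase in_rect; lia.
rewrite !logZ_drop_row0 -!/(logZ _ _).
by congr (`|_| <= _); lra.
Qed.

End Grid.

(** * Sequences with small second differences *)

Section Sequences.
Variable R : realType.

(** With [d n = b n.+1 - b n] and [E n = K / (1 - theta) * theta ^+ n], the
    sequences [d - E] and [d + E] are adjacent: the first increases, the second
    decreases, and [delta] lies between them. *)
Lemma second_diff_asymptotics (b : nat -> R) (K theta : R) :
  0 < theta < 1 ->
  (forall n, `|b n.+2 - 2 * b n.+1 + b n| <= K * theta ^+ n) ->
  exists delta, forall n,
    `|b n.+1 - b n - delta| <= K / (1 - theta) * theta ^+ n /\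
    `|b n - b 0%N - n%:R * delta| <= K / (1 - theta) ^+ 2.
Proof.
move=> /andP[th0 th1] hb.
have K0 : 0 <= K by have := hb 0%N; rewrite expr0 mulr1; apply: le_trans.
have t0 : 0 < 1 - theta by rewrite subr_gt0.
set t := (1 - theta)^-1; have tE : t * (1 - theta) = 1 by rewrite mulVf ?gt_eqF.
have t_gt0 : 0 < t by rewrite invr_gt0.
pose d n := b n.+1 - b n.
pose E n := K * t * theta ^+ n.
have E0 n : 0 <= E n by rewrite !mulr_ge0 ?exprn_ge0 ?(ltW t_gt0) ?(ltW th0).
have ES n : E n - E n.+1 = K * theta ^+ n.
  by rewrite /E exprS -[RHS]mul1r -tE; ring.
have dS n : `|d n.+1 - d n| <= E n - E n.+1.
  rewrite ES (_ : d n.+1 - d n = b n.+2 - 2 * b n.+1 + b n) // /d; ring.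
have low : {homo (fun n => d n - E n) : m n / (m <= n)%N >-> m <= n}.
  apply: homo_leq => [x|x y z|n]; [exact: lexx|exact: le_trans|].
  by have := dS n; rewrite ler_norml; lra.
have upp : {homo (fun n => d n + E n) : m n / (m <= n)%N >-> n <= m}.
  apply: homo_leq => [x|x y z yx zy|n]; [exact: lexx|exact: le_trans zy yx|].
  by have := dS n; rewrite ler_norml; lra.
have lu m n : d m - E m <= d n + E n.
  have := low _ _ (leq_maxl m n); have := upp _ _ (leq_maxr m n).
  by have := E0 (maxn m n); rewrite /=; lra.
pose delta := sup (range (fun n => d n - E n)).
have hs : has_sup (range (fun n => d n - E n)).
  split; first by exists (d 0%N - E 0%N), 0%N.
  by exists (d 0%N + E 0%N) => _ [m _ <-]; apply: lu.
have d1 n : `|d n - delta| <= E n.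
  rewrite ler_distl; apply/andP; split.
    by rewrite lerBlDr; apply: sup_le_ub => [|_ [m _ <-]]; [exact: hs.1|exact: lu].
  by rewrite -lerBlDr; apply: sup_ubound; [exact: hs.2|exists n].
exists delta => n; split; first exact: d1.
(* Summing [E 0 + ... + E n.-1] gives this sharper bound, which the induction
   needs. *)
have : `|b n - b 0%N - n%:R * delta| <= K * t ^+ 2 * (1 - theta ^+ n).
  elim: n => [|n IH]; first by rewrite expr0 !subrr mul0r mulr0 subrr normr0.
  have := d1 n; have -> : E n = K * t ^+ 2 * (theta ^+ n - theta ^+ n.+1).
    by rewrite /E [theta ^+ n.+1]exprS -[LHS]mul1r -tE; ring.
  rewrite /d -[n.+1]addn1 natrD mulrDl mul1r; move: IH.
  rewrite !ler_norml; lra.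
move=> /le_trans; apply; rewrite -exprVn -/t.
rewrite ler_piMr ?mulr_ge0 ?exprn_ge0 ?(ltW t_gt0)//.
by rewrite gerBl exprn_ge0// ltW.
Qed.

Lemma le_of_mulrn_le (x y c : R) :
  (forall m : nat, m%:R * x <= m%:R * y + c) -> x <= y.
Proof.
move=> h; rewrite leNgt; apply/negP => yx.
have xy0 : 0 < x - y by rewrite subr_gt0.
have c0 : 0 <= c by have := h 0%N; rewrite !mul0r add0r.
have := archi_boundP (divr_ge0 c0 (ltW xy0)).
rewrite ltr_pdivrMr// => cN; have := h (Num.bound (c / (x - y))); lra.
Qed.

Section DoubleSequence.
Variables (a : nat -> nat -> R) (K theta : R).
Hypotheses (theta01 : 0 < theta < 1) (aC : forall m n, a m n = a n m).
Hypothesis a0 : forall n, a 0%N n = 0.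
Hypothesis ha : forall m n,
  `|a m n.+2 - 2 * a m n.+1 + a m n| <= m%:R * (K * theta ^+ n).

(** The hypothesis on the second variable gives, by symmetry, the existence of
    the linear growth rate [d n] of [a m n] in [m]; the hypothesis itself, divided
    by [m], then passes to [d].  The error terms are uniform enough to control
    [a m n / (m n)] when [m] and [n] go to infinity independently. *)
Lemma double_sequence_asymptotics :
  exists (d : nat -> R) (delta : R),
  [/\ forall m n, `|a m n - m%:R * d n| <= n%:R * (K / (1 - theta) ^+ 2),
      forall n, `|d n.+1 - d n - delta| <= K / (1 - theta) * theta ^+ n
    & forall n, `|d n - n%:R * delta| <= K / (1 - theta) ^+ 2].
Proof.
have /choice [d hd] n : exists dn, forall m,
    `|a m n - m%:R * dn| <= n%:R * (K / (1 - theta) ^+ 2).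
  have hn m : `|a m.+2 n - 2 * a m.+1 n + a m n| <= n%:R * K * theta ^+ m.
    by rewrite ![a _ n]aC -mulrA.
  have [dn hdn] := second_diff_asymptotics theta01 hn.
  exists dn => m; have [_] := hdn m.
  by rewrite a0 subr0 mulrA.
have hdd n : `|d n.+2 - 2 * d n.+1 + d n| <= K * theta ^+ n.
  set C := K / (1 - theta) ^+ 2 in hd.
  (* The weights of the three errors: [4 n.+1 = n.+2 + 2 n.+1 + n]. *)
  apply: (@le_of_mulrn_le _ _ ((4 * n.+1)%:R * C)) => m.
  have := hd n.+2 m; have := hd n.+1 m; have := hd n m; have := ha m n.
  have -> : m%:R * `|d n.+2 - 2 * d n.+1 + d n| =
    `|m%:R * (d n.+2 - 2 * d n.+1 + d n)| by rewrite normrM normr_nat.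
  rewrite natrM -[n.+2]addn2 -[n.+1]addn1 !natrD !ler_norml; lra.
have [delta hdelta] := second_diff_asymptotics theta01 hdd.
exists d, delta; split=> // n; first by have [] := hdelta n.
have d0 : d 0%N = 0.
  have := hd 0%N 1%N; rewrite mul0r mul1r aC a0 sub0r normrN.
  by rewrite normr_le0 => /eqP.
by have [_] := hdelta n; rewrite d0 subr0.
Qed.

End DoubleSequence.

Lemma cvg_multi_oo (k : nat) (f : ('I_k -> nat) -> R) (l C : R) :
  (forall (N : nat) j, (forall i, (N < j i)%N) -> `|f j - l| <= C / N.+1%:R) ->
  f @ @multi_oo k --> l.
Proof.
move=> h; apply/cvgrPdist_le => eps eps0.
pose N := Num.bound (C / eps).
exists N.+1 => // j jN.
rewrite distrC (le_trans (h N j jN))// ler_pdivrMr// mulrC -ler_pdivrMr//.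
have C0 : 0 <= C.
  by have := h 0%N (fun=> 1%N) (fun=> isT); rewrite divr1; apply: le_trans.
by rewrite ltW// (lt_trans (archi_boundP (divr_ge0 C0 (ltW eps0))))// ltr_nat.
Qed.

End Sequences.

(** * Patterns as independent sets *)

Lemma card_bij_fset (T : finType) (U : choiceType) (D : {set T}) (F : {fset U})
    (f : T -> U) :
  {in D &, injective f} -> (forall y, y \in F <-> exists2 x, x \in D & f x = y) ->
  #|D| = #|` F|.
Proof.
move=> f_inj fF; rewrite cardE -(size_map f).
apply/perm_size/uniq_perm; rewrite ?fset_uniq//.
  rewrite map_inj_in_uniq ?enum_uniq// => x y.
  by rewrite !mem_enum; apply: f_inj.
move=> y; apply/mapP/idP => [[x]|/fF[x xD <-]].
  by rewrite mem_enum => xD ->; apply/fF; exists x.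
by exists x; rewrite ?mem_enum.
Qed.

Lemma adjacent_sites2 (u v : site 2) :
  adjacent_sites u v = (`|u 0 0 - v 0 0| + `|u 0 1 - v 0 1| == 1).
Proof.
rewrite /adjacent_sites !big_ord_recl big_ord0 addr0.
by rewrite (_ : lift ord0 ord0 = 1)//; apply/val_inj.
Qed.

(** The shift by 1 is there because the boxes of the entropy start at 1. *)
Definition point (x : nat * nat) : site 2 :=
  \row_(i < 2) if i == 0 then x.1.+1%:Z else x.2.+1%:Z.

Lemma adjacent_point x y : adjacent_sites (point x) (point y) = adj x y.
Proof.
case: x y => a b [c d]; rewrite adjacent_sites2 !mxE /adj /=.
by apply/idP/idP; lia.
Qed.

Lemma point_inj : injective point.
Proof.
move=> [a b] [c d] /rowP h; have := h 0; have := h 1; rewrite !mxE /=.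
by move=> [->] [->].
Qed.

Lemma point_box (j : 'I_2 -> nat) x : (point x \in box j) = (x \in rect (j 0) (j 1)).
Proof.
rewrite in_box in_rect; apply/forallP/andP => [h|[h0 h1] i].
  by have := h 0; have := h 1; rewrite !mxE /=.
rewrite mxE; case: i => -[|[|//]] i2 /=.
  by rewrite (_ : Ordinal i2 = 0)//; apply/val_inj.
by rewrite (_ : Ordinal i2 = 1)//; apply/val_inj.
Qed.

Lemma box_point (j : 'I_2 -> nat) v : v \in box j -> exists x, v = point x.
Proof.
rewrite in_box => /forallP h; exists (`|v 0%R 0%R|.-1, `|v 0%R 1%R|.-1)%N.
apply/rowP => i; rewrite mxE; have := h i; case: i => -[|[|//]] i2 /=.
  by rewrite (_ : Ordinal i2 = 0)/=; [lia|apply/val_inj].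
by rewrite (_ : Ordinal i2 = 1)//=; [lia|apply/val_inj].
Qed.

(** Every independent set of the box is the trace of a point of the shift, since
    it may be extended by zeros; so patterns are independent sets. *)
Lemma card_language_hard_square (j : 'I_2 -> nat) :
  #|language (box j) hard_square| = nind adj (rect (j 0) (j 1)).
Proof.
pose ext (p : {ffun box j -> bool}) (x : nat * nat) :=
  if insub (point x) is Some s then p s else false.
have extE (y : config 2 bool) x : x \in rect (j 0) (j 1) ->
    ext (restriction (box j) y) x = y (point x).
  by move=> xr; rewrite /ext insubT ?point_box// => sx; rewrite ffunE.
apply: (@card_bij_fset _ _ _ _ (fun p => [fset x in rect (j 0) (j 1) | ext p x])).
  move=> p q _ _ /fsetP pq; apply/ffunP => s.
  have [x sx] := box_point (valP s).
  have := pq x; rewrite !in_fsetsep -!point_box -sx (valP s) /= /ext.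
  by rewrite -sx valK.
move=> I; rewrite in_indsets; split.
  move=> /andP[/fsubsetP IG /independentP indI].
  pose y : config 2 bool := fun v => v \in [fset point x | x in I].
  have yE x : y (point x) = (x \in I).
    by apply: mem_imfset; apply: point_inj.
  exists (restriction (box j) y).
    rewrite inE; apply/asboolP; exists y => // u v uv.
    apply/negP => /andP[/imfsetP[a /= aI uE] /imfsetP[b /= bI vE]].
    by have := indI a b aI bI; rewrite -adjacent_point -uE -vE uv.
  apply/fsetP => x; rewrite in_fsetsep; apply/andP/idP => [[xr]|xI].
    by rewrite extE// yE.
  by split; [apply: IG|rewrite extE ?yE//; apply: IG].
move=> [p]; rewrite inE => /asboolP[y hy <-] <-.
rewrite fset_sub /=; apply/independentP => a b.
rewrite !in_fsetsep => /andP[ar] + /andP[br]; rewrite !extE// => ya yb.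
apply/negP; rewrite -adjacent_point => ab.
by have := hy _ _ ab; rewrite ya yb.
Qed.

Lemma adjacent_strip n (a b : nat) (k l : 'I_n) :
  adjacent_sites (strip_site a.+1 k) (strip_site b.+1 l) =
  adj (a, val k) (b, val l).
Proof.
rewrite -adjacent_point.
by congr adjacent_sites; apply/rowP => i; rewrite !mxE.
Qed.

Lemma const_box (j : 'I_1 -> nat) (a : nat) :
  (const_mx a.+1%:Z : site 1) \in box j = (a < j 0%R)%N.
Proof.
rewrite in_box; apply/forallP/idP => [/(_ 0)|h i]; rewrite mxE; first by lia.
by rewrite (ord1 i); lia.
Qed.

Lemma box_const (j : 'I_1 -> nat) v : v \in box j ->
  v = const_mx (`|v 0%R 0%R|.-1.+1%:Z).
Proof.
rewrite in_box => /forallP h; apply/rowP => i.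
by have := h i; rewrite mxE (ord1 i) /=; lia.
Qed.

(** A word of [m] legal columns of height [n] is an independent set of the
    [m * n] rectangle; again an independent set extends by zeros. *)
Lemma card_language_strip (n : nat) (j : 'I_1 -> nat) :
  #|language (box j) (@strip_shift n)| = nind adj (rect (j 0) n).
Proof.
pose ext (p : {ffun box j -> column n}) (x : nat * nat) :=
  if (insub (const_mx x.1.+1%:Z), insub x.2) is (Some s, Some k)
  then val (p s) k else false.
have extE (y : config 1 (column n)) a (k : 'I_n) : (a < j 0%R)%N ->
    ext (restriction (box j) y) (a, val k) = val (y (const_mx a.+1%:Z)) k.
  move=> aj; rewrite /ext insubT ?const_box// => sx /=.
  by rewrite valK ffunE.
apply: (@card_bij_fset _ _ _ _ (fun p => [fset x in rect (j 0) n | ext p x])).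
  move=> p q _ _ /fsetP pq; apply/ffunP => s; apply/val_inj/ffunP => k.
  have sE := box_const (valP s); set a := _.-1 in sE.
  have aj : (a < j 0%R)%N by rewrite -const_box -sE (valP s).
  have := pq (a, val k); rewrite !in_fsetsep !in_rect /= aj ltn_ord /= /ext /=.
  by rewrite -sE !valK.
move=> I; rewrite in_indsets; split.
  move=> /andP[/fsubsetP IG /independentP indI].
  pose c (v : site 1) : {ffun 'I_n -> bool} :=
    [ffun k => (0 < v 0%R 0%R) && ((`|v 0%R 0%R|.-1%N, val k) \in I)].
  have c_legal (u v : site 1) k l :
      adjacent_sites (strip_site (u 0 0) k) (strip_site (v 0 0) l) ->
      ~~ (c u k && c v l).
    move=> kl; rewrite !ffunE; apply/negP => /andP[/andP[u0 uI] /andP[v0 vI]].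
    have := indI _ _ uI vI; rewrite -adjacent_strip.
    have pE (z : int) : 0 < z -> `|z|.-1.+1%:Z = z by lia.
    by rewrite !pE// kl.
  have cL v : column_legal (c v).
    apply/forallP => k; apply/forallP => l; apply/implyP => kl.
    apply: c_legal; move: kl; rewrite !adjacent_sites2 !mxE /=; lia.
  pose y : config 1 (column n) := fun v => exist _ (c v) (cL v).
  have yE a (k : 'I_n) : val (y (const_mx a.+1%:Z)) k = ((a, val k) \in I).
    by rewrite /= ffunE mxE.
  exists (restriction (box j) y).
    rewrite inE; apply/asboolP; exists y => // a b k l kl.
    by apply: c_legal; rewrite !mxE.
  apply/fsetP => -[a b]; rewrite in_fsetsep; apply/andP/idP => [[xr]|xI].
    have := xr; rewrite in_rect /= => /andP[aj bn].
    by rewrite (extE y a (Ordinal bn))// yE.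
  have := IG _ xI; rewrite in_rect => /andP[/= aj bn].
  split; first by rewrite aj bn.
  by rewrite (extE y a (Ordinal bn))// yE.
move=> [p]; rewrite inE => /asboolP[y hy <-] <-.
rewrite fset_sub /=; apply/independentP => -[a k] [b l].
rewrite !in_fsetsep => /andP[ar] + /andP[br].
move: ar br; rewrite !in_rect => /andP[/= aj kn] /andP[/= bj ln].
rewrite (extE y a (Ordinal kn))// (extE y b (Ordinal ln))// => ya yb.
apply/negP => ab.
have := hy a.+1%:Z b.+1%:Z (Ordinal kn) (Ordinal ln).
by rewrite adjacent_strip ya yb => /(_ ab).
Qed.

(** * Entropies *)

Section Entropies.
Variables (R : realType) (d : nat -> R) (delta C : R).
Hypothesis logZ_d : forall m n, `|logZ R m n - m%:R * d n| <= n%:R * C.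
Hypothesis d_delta : forall n, `|d n - n%:R * delta| <= C.

Lemma htop_strip n : htop R (@strip_shift n) = d n.
Proof.
apply: cvg_lim => //; apply: (@cvg_multi_oo _ _ _ _ (n%:R * C)) => N j jN.
rewrite card_language_strip -/(lognind _ _) -/(logZ _ _ _).
rewrite big_ord_recl big_ord0 muln1 -[ord0]/(0 : 'I_1).
have m0 : 0 < (j 0)%:R :> R by rewrite ltr0n (leq_ltn_trans _ (jN 0)).
rewrite (_ : _ / _ - _ = (logZ R (j 0) n - (j 0)%:R * d n) / (j 0)%:R); last first.
  by rewrite mulrBl mulrAC divff ?mul1r// gt_eqF.
rewrite normrM normfV (gtr0_norm m0) ler_pM ?invr_ge0 ?(ltW m0) ?logZ_d//.
by rewrite lef_pV2 ?posrE// ler_nat jN.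
Qed.

Lemma htop_hard_square : htop R hard_square = delta.
Proof.
apply: cvg_lim => //; apply: (@cvg_multi_oo _ _ _ _ (2 * C)) => N j jN.
rewrite card_language_hard_square -/(lognind _ _) -/(logZ _ _ _).
rewrite !big_ord_recl big_ord0 muln1 (_ : lift ord0 ord0 = 1); last exact/val_inj.
rewrite -[ord0]/(0 : 'I_2).
move: (j 0) (j 1) (jN 0) (jN 1) => m n mN nN.
have m0 : 0 < m%:R :> R by rewrite ltr0n (leq_ltn_trans _ mN).
have n0 : 0 < n%:R :> R by rewrite ltr0n (leq_ltn_trans _ nN).
have -> : logZ R m n / (m * n)%:R - delta =
    (logZ R m n - m%:R * d n) / n%:R / m%:R + (d n - n%:R * delta) / n%:R.
  by rewrite natrM; field; rewrite !gt_eqF.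
have inv_le k : (N < k)%N -> (k%:R : R)^-1 <= N.+1%:R^-1.
  by move=> Nk; rewrite lef_pV2 ?posrE ?ltr0n ?ler_nat// (leq_ltn_trans _ Nk).
rewrite (_ : 2 * C / N.+1%:R = C / N.+1%:R + C / N.+1%:R); last by ring.
rewrite (le_trans (ler_normD _ _))// lerD//.
  rewrite normrM normfV (gtr0_norm m0) ler_pM ?invr_ge0 ?(ltW m0) ?inv_le//.
  by rewrite normrM normfV (gtr0_norm n0) ler_pdivrMr// [leRHS]mulrC logZ_d.
by rewrite normrM normfV (gtr0_norm n0) ler_pM ?invr_ge0 ?(ltW n0) ?inv_le.
Qed.

End Entropies.

Theorem theorem1 (R : realType) :
  let h : R := htop R hard_square in
  let h_ (n : nat) : R := htop R (@strip_shift n) in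
  ((fun n : nat => h_ n.+1 - h_ n) @ \oo --> h) /\
  exists A B : R, [/\ 0 < A, 0 < B &
    forall n : nat, (1 <= n)%N ->
      `|h_ n.+1 - h_ n - h| <= A * expR (- (B * n%:R))].
Proof.
have theta01 : 0 < (7 / 8 : R) < 1 by lra.
have [d [delta [logZ_d d_diff d_delta]]] :=
  double_sequence_asymptotics theta01 (@logZC R) (@logZ0 R) (@logZ_second_diff R).
rewrite /= (htop_hard_square logZ_d d_delta).
under eq_fun do rewrite !(htop_strip logZ_d).
have ln2 : 0 < ln 2 :> R by rewrite ln_gt0 ?ltr1n.
have A0 : 0 < ln 2 / (1 - 7 / 8) :> R by rewrite divr_gt0//; lra.
split.
  have th_lt1 : `|7 / 8 : R| < 1 by rewrite ger0_norm; lra.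
  apply/cvgrPdist_le => eps eps0.
  have /cvgrPdist_le/(_ _ eps0) := cvg_geometric (ln 2 / (1 - 7 / 8) : R) th_lt1.
  apply: filterS => n; rewrite sub0r normrN distrC => /(le_trans (ler_norm _)).
  by apply: le_trans; apply: d_diff.
exists (ln 2 / (1 - 7 / 8)), (ln (8 / 7)); split=> //.
  by rewrite ln_gt0; lra.
move=> n _; rewrite !(htop_strip logZ_d) (le_trans (d_diff n))//.
rewrite (_ : - (ln (8 / 7) * n%:R) = n%:R * - ln (8 / 7)); last by ring.
by rewrite expRM_natl expRN lnK ?posrE ?divr_gt0// invf_div.
Qed.
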